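(* Let $n \geq 4$ and let $v_1, v_2, \ldots, v_n$ be positive integers with $\gcd(v_1,\ldots,v_n) = 1$ and $\gcd(v_1,\ldots,v_{n-1}) = g \geq 2$. Suppose that the Lonely Runner Conjecture holds for $v_1,\ldots,v_{n-1}$, i.e. $\mathrm{ML}(v_1,\ldots,v_{n-1}) \geq \frac{1}{n}$. Then $$\mathrm{ML}(v_1,\ldots,v_n) \geq \frac{1}{n}.$$
   Context: For real $x$, $\|x\|$ denotes the distance from $x$ to the nearest integer. For positive speeds $v_1,\ldots,v_m$, the maximum loneliness is $\mathrm{ML}(v_1,\ldots,v_m) = \max_{t\in\mathbb{R}} \min_{1\le i\le m} \|t v_i\|$. The Lonely Runner Conjecture for $m$ speeds $v_1,\ldots,v_m$ is the assertion $\mathrm{ML}(v_1,\ldots,v_m) \geq \frac{1}{m+1}$. *)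

(* Defs.v *)
From mathcomp Require Import all_boot all_order all_algebra.
From mathcomp Require Import all_classical all_reals all_analysis.
From mathcomp Require Import lra.

Set Implicit Arguments.
Unset Strict Implicit.
Unset Printing Implicit Defensive.

Import Order.TTheory GRing.Theory Num.Theory.
Import numFieldNormedType.Exports.

Local Open Scope classical_set_scope.
Local Open Scope ring_scope.

Definition dist_int (R : realType) (x : R) : R :=
  inf [set `|x - k%:~R| | k in [set: int]].

(* The neutral element 1/2 does not affect the minimum over a nonempty family,
   since [dist_int x <= 1/2] for every [x] (see [dist_int_le_half]). *)
Definition min_dist (R : realType) (m : nat) (v : 'I_m -> R) (t : R) : R :=
  \big[Num.min/2^-1]_(i < m) dist_int (t * v i).

(* The supremum is a maximum for integer speeds, see [ML_is_max]. *)
Definition ML (R : realType) (m : nat) (v : 'I_m -> R) : R :=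
  sup (range (min_dist v)).

Section Facts.
Variable R : realType.

Lemma dist_int_lbound (x : R) :
  lbound [set `|x - k%:~R| | k in [set: int]] 0.
Proof. by move=> _ [k _ <-]. Qed.

Lemma dist_int_le (x : R) (k : int) : dist_int x <= `|x - k%:~R|.
Proof. by apply: ge_inf; [exists 0; exact: dist_int_lbound | exists k]. Qed.

Lemma dist_int_ge (x y : R) :
  (forall k : int, y <= `|x - k%:~R|) -> y <= dist_int x.
Proof.
move=> h; apply: lb_le_inf; first by exists `|x - 0%:~R|, 0.
by move=> _ [k _ <-].
Qed.

Lemma dist_int_le_half (x : R) : dist_int x <= 2^-1.
Proof.
have := floor_itv x; set k := Num.floor x; rewrite intrD => /andP[h1 h2].
have [h|h] := lerP (x - k%:~R) 2^-1.
  by rewrite (le_trans (dist_int_le x k))// ger0_norm// subr_ge0.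
rewrite (le_trans (dist_int_le x (k + 1)))// intrD ler0_norm ?subr_le0 1?ltW//.
lra.
Qed.

Lemma dist_int_lip (x y : R) : dist_int x <= dist_int y + `|x - y|.
Proof.
rewrite -lerBlDr; apply: dist_int_ge => k; rewrite lerBlDr.
apply: le_trans (dist_int_le x k) _.
by rewrite -(subrKA y) addrC ler_normD.
Qed.

Lemma dist_intDz (x : R) (k : int) : dist_int (x + k%:~R) = dist_int x.
Proof.
apply/le_anti/andP; split; apply: dist_int_ge => j.
  apply: le_trans (dist_int_le _ (j + k)) _.
  by rewrite intrD opprD addrACA subrr addr0.
apply: le_trans (dist_int_le _ (j - k)) _.
by rewrite intrB opprB addrA.
Qed.

Lemma dist_int_continuous : continuous (@dist_int R).
Proof.
move=> x; apply/cvgrPdist_le => e e0; near=> y.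
have xy : `|x - y| <= e by near: y; apply: cvgr_dist_le.
apply: le_trans xy; rewrite ler_distl.
have := dist_int_lip x y; have := dist_int_lip y x; rewrite (distrC y).
lra.
Unshelve. all: by end_near. Qed.

Lemma min_dist_continuous (m : nat) (v : 'I_m -> R) :
  continuous (min_dist v).
Proof.
rewrite /min_dist; elim: (index_enum _) => [|i s ih] t.
  by under eq_fun do rewrite big_nil; exact: cvg_cst.
under eq_fun do rewrite big_cons.
apply: (@continuous_min _ _ (fun u : R => dist_int (u * v i))
  (fun u : R => \big[Num.min/2^-1]_(j <- s) dist_int (u * v j)));
  last exact: ih.
apply: (continuous_comp (f := fun u : R => u * v i)); last first.
  exact: dist_int_continuous.
by apply: cvgM; [exact: cvg_id | exact: cvg_cst].
Qed.

Lemma min_dist_floor (m : nat) (v : 'I_m -> nat) (t : R) :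
  min_dist (fun i => (v i)%:R) (t - (Num.floor t)%:~R)
  = min_dist (fun i => (v i)%:R) t.
Proof.
rewrite /min_dist; apply: eq_bigr => i _.
have -> : (t - (Num.floor t)%:~R) * (v i)%:R
    = t * (v i)%:R + (- Num.floor t * (v i)%:Z)%:~R.
  by rewrite intrM intrN mulrBl mulNr.
exact: dist_intDz.
Qed.

Lemma ML_is_max (m : nat) (v : 'I_m -> nat) :
  exists2 t : R, ML (fun i => (v i)%:R) = min_dist (fun i => (v i)%:R) t
    & forall u : R,
        min_dist (fun i => (v i)%:R) u <= min_dist (fun i => (v i)%:R) t.
Proof.
set f := min_dist _.
have [t _ ht] : exists2 t, t \in `[0, 1] & forall u, u \in `[0, 1] -> f u <= f t.
  apply: EVT_max => //; apply: continuous_subspaceT.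
  exact: min_dist_continuous.
have hmax u : f u <= f t.
  rewrite /f -(min_dist_floor v u); apply: ht.
  by have := floor_itv u; rewrite in_itv/= intrD; lra.
exists t => //; apply/le_anti/andP; split.
  by apply: ge_sup; [exists (f t), t | move=> _ [u _ <-]].
by apply: ub_le_sup; [exists (f t) => _ [u _ <-] | exists t].
Qed.

End Facts.

(* Main.v *)
Require Import Defs.
From mathcomp Require Import all_boot all_order all_algebra.
From mathcomp Require Import all_classical all_reals all_analysis.
From mathcomp Require Import ring lra.

Import Order.TTheory GRing.Theory Num.Theory.

Local Open Scope ring_scope.

(** Fix a time [t] at which the first [n - 1] runners are all lonely. All of
    their speeds are multiples of [g], so shifting [t] by a multiple of [1 / g]
    moves each of them by an integer and keeps them lonely. The last speed [w]
    is coprime to [g]: a Bezout relation turns any prescribed displacement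
    [m / g] of the last runner, modulo 1, into such a shift
    ([exists_time_shift]). The positions it can reach are therefore spaced by
    [1 / g] on the circle, and one of them lies within [1 / (2 g)] of the point
    [1 / 2] ([exists_translate_far]). There its distance to the nearest integer
    is at least [1 / 2 - 1 / (2 g)], which is at least [1 / 4], hence at least
    [1 / n], as [g >= 2] and [n >= 4]. *)

Lemma dist_int_half (R : realType) : dist_int (2^-1 : R) = 2^-1.
Proof.
apply/le_anti; rewrite dist_int_le_half; apply: dist_int_ge => k.
have [k_le0|k_gt0] := leP k 0.
  have : (k%:~R : R) <= 0 by rewrite lerz0.
  by rewrite ler_normr => ?; apply/orP; left; lra.
have : 1 <= (k%:~R : R) by rewrite ler1z -gtz0_ge1.
by rewrite ler_normr => ?; apply/orP; right; lra.
Qed.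

(** The translates of [x] by multiples of [1 / g] are spaced by [1 / g], so one
    of them is within half a step of [1 / 2]; [dist_int] is 1-Lipschitz. *)
Lemma exists_translate_far (R : realType) (g : nat) (x : R) : (0 < g)%N ->
  exists m : int, 2^-1 - (2 * g%:R)^-1 <= dist_int (x + m%:~R / g%:R).
Proof.
move=> g_gt0; have g0 : 0 < (g%:R : R) by rewrite ltr0n.
(* The integer nearest to [g * (1 / 2 - x)], so that [x + m / g] is nearest
   to [1 / 2]. *)
pose m := Num.floor (g%:R * (2^-1 - x) + 2^-1); exists m.
have := floor_itv (g%:R * (2^-1 - x) + 2^-1); rewrite -/m intrD => m_itv.
have near_half : `|2^-1 - (x + m%:~R / g%:R)| <= (2 * g%:R)^-1.
  have -> : 2^-1 - (x + m%:~R / g%:R)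
      = (g%:R * (2^-1 - x) - m%:~R) / g%:R by field; rewrite gt_eqF.
  rewrite normrM normfV (gtr0_norm g0) invfM ler_pM2r ?invr_gt0// ler_norml.
  by move: m_itv; lra.
have := dist_int_lip 2^-1 (x + m%:~R / g%:R); rewrite dist_int_half.
by move: near_half; lra.
Qed.

(** If [a * g + b * w = 1], then the shift [m * b / g] displaces speed [w] by
    [m / g - m * a]. *)
Lemma exists_time_shift (R : realType) (g w : nat) (t : R) (m : int) :
  (0 < g)%N -> coprime g w ->
  exists u : R,
    (forall v : nat, (g %| v)%N -> dist_int (u * v%:R) = dist_int (t * v%:R))
    /\ dist_int (u * w%:R) = dist_int (t * w%:R + m%:~R / g%:R).
Proof.
move=> g_gt0 cop_gw; have g0 : (g%:R : R) != 0 by rewrite pnatr_eq0 -lt0n.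
have /coprimezP[[a b] /= bezout] : coprimez g w by [].
have bezoutR : a%:~R * g%:R + b%:~R * w%:R = 1 :> R.
  by rewrite -(intrM _ a g) -(intrM _ b w) -intrD bezout.
exists (t + (m * b)%:~R / g%:R); split=> [v /dvdnP[q ->]|].
  rewrite -[RHS](dist_intDz _ (m * b * q)); congr dist_int.
  by rewrite natrM !intrM; field.
rewrite -[RHS](dist_intDz _ (- (m * a))); congr dist_int.
have -> : m%:~R / g%:R = m%:~R * (a%:~R * g%:R + b%:~R * w%:R) / g%:R :> R.
  by rewrite bezoutR mulr1.
by rewrite intrN !intrM; field.
Qed.

Theorem theorem2p1 (R : realType) (n : nat) (v : 'I_n -> nat) (g : nat)
  (hn : (4 <= n)%N)
  (hv : forall i : 'I_n, (0 < v i)%N)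
  (hgcd : \big[gcdn/0%N]_(i < n) v i = 1%N)
  (hg : \big[gcdn/0%N]_(i < n.-1) v (widen_ord (leq_pred n) i) = g)
  (hg2 : (2 <= g)%N)
  (hLRC : n%:R^-1 <= ML (fun i : 'I_n.-1 => (v (widen_ord (leq_pred n) i))%:R : R)) :
  n%:R^-1 <= ML (fun i : 'I_n => (v i)%:R : R).
Proof.
case: n => [//|n] in v hn hv hgcd hg hLRC *; rewrite /= in hg hLRC.
have widenE (i : 'I_n) : widen_ord (leq_pred n.+1) i = widen_ord (leqnSn n) i.
  exact: val_inj.
have g_gt0 : (0 < g)%N by exact: ltnW.
have cop_g : coprime g (v ord_max).
  rewrite /coprime -hgcd big_ord_recr /= -hg; apply/eqP; congr gcdn.
  by apply: eq_bigr => i _; rewrite widenE.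
have inv_le4 : (n.+1%:R^-1 : R) <= 4^-1.
  by rewrite lef_pV2 ?posrE ?ltr0n// ler_nat.
have [t ML_t _] := ML_is_max R (fun i : 'I_n => v (widen_ord (leq_pred n.+1) i)).
have [m far_m] := exists_translate_far R g (t * (v ord_max)%:R) g_gt0.
have [u [u_slow u_last]] := exists_time_shift R g (v ord_max) t m g_gt0 cop_g.
have [s -> s_max] := ML_is_max R v.
apply: le_trans (s_max u); rewrite /min_dist.
apply: le_bigmin => [|i _]; first by apply: le_trans inv_le4 _; lra.
have [i_lt|i_ge] := ltnP i n.
  have -> : i = widen_ord (leq_pred n.+1) (Ordinal i_lt) by exact: val_inj.
  rewrite u_slow; last by rewrite -hg; exact: (biggcdn_inf (Ordinal i_lt)).
  by apply: le_trans hLRC _; rewrite ML_t /min_dist; exact: bigmin_le.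
have -> : i = ord_max.
  by apply: val_inj; apply/eqP; rewrite eqn_leq i_ge -ltnS ltn_ord.
rewrite u_last; apply: le_trans far_m.
have : ((2 * g%:R)^-1 : R) <= 4^-1.
  by rewrite lef_pV2 ?posrE -?natrM ?ltr0n ?muln_gt0// ler_nat (leq_mul2l 2 2).
by move=> far4; apply: le_trans inv_le4 _; lra.
Qed.
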